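(* Let $a\ge 1$ be an odd integer and $n\ge 2$ an even integer. Then the center of $\Pi^a_n$ is $Z(\Pi^a_n)=U^a_n$.
   Context: For integers $a\ge 1$ and $n\ge 0$, let $\mathcal{S}^a_n$ be the set of all words $\alpha_1\cdots\alpha_n$ of length $n$ over the alphabet $\{0,1,\dots,a\}$ such that the letter $a$ appears only immediately after a letter $0$ (so $\alpha_1\ne a$, and $\alpha_i=a$ implies $\alpha_{i-1}=0$). The metallic cube $\Pi^a_n$ is the simple graph with vertex set $\mathcal{S}^a_n$ in which two vertices $\alpha,\beta$ are adjacent if and only if $\sum_{k=1}^n|\alpha_k-\beta_k|=1$, i.e. one is obtained from the other by replacing a single letter $k$ by $k+1$, $0\le k\le a-1$. For a connected graph $G$, $d(v,w)$ is the shortest-path distance, $e(v)=\max_{w\in V(G)}d(v,w)$ is the eccentricity of $v$, $r(G)=\min_{v\in V(G)}e(v)$ is the radius, and the center is $Z(G)=\{v\in V(G): e(v)=r(G)\}$. Let $\epsilon=\lfloor a/2\rfloor$ and let $\hat\epsilon=\epsilon\cdots\epsilon$ be the word of length $n$ with all letters equal to $\epsilon$. The set $U^a_n\subseteq V(\Pi^a_n)$ consists of all vertices $v$ of $\Pi^a_n$ such that: (1) $v$ differs from $\hat\epsilon$ in at most one position, i.e. $v=\epsilon\cdots\epsilon\,\alpha\,\epsilon\cdots\epsilon$ with $\alpha=\epsilon$ or $\alpha=\epsilon\pm1$; (2) the letter $\epsilon+1$ can appear only in even positions; (3) the letter $\epsilon-1$ can appear only in odd positions. Positions are numbered $1,\dots,n$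 from left to right. *)

(* Defs.v *)
From HB Require Import structures.
From mathcomp Require Import all_boot all_order all_algebra.

Set Implicit Arguments.
Unset Strict Implicit.
Unset Printing Implicit Defensive.

Import IntDist.

Section GraphMetric.
Variables (T : finType) (e : rel T).

(* Least length of an e-path from x to y.  A shortest path visits each vertex
   at most once, so lengths below #|T| suffice; the value is #|T| if x and y
   are not connected. *)
Definition gdist (x y : T) : nat :=
  find (fun k => [exists p : k.-tuple T, path e x p && (last x p == y)])
       (iota 0 #|T|).

Definition ecc (v : T) : nat := \max_(w : T) gdist v w.

(* The default #|T| bounds all eccentricities, so this is the true minimum
   whenever T is nonempty. *)
Definition radius : nat := \big[minn/#|T|]_(v : T) ecc v.

Definition center : {set T} := [set v | ecc v == radius].

Lemma gdist_min x y p : path e x p -> last x p = y -> gdist x y <= size p.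
Proof.
move=> ep lp; rewrite /gdist; case: (ltnP (size p) #|T|) => [ltp|lep]; last first.
  by apply: leq_trans lep; rewrite -[leqRHS](size_iota 0); apply: find_size.
rewrite leqNgt; apply/negP => /(before_find 0).
rewrite nth_iota // add0n => /existsP; case.
by exists (in_tuple p); rewrite /= ep lp eqxx.
Qed.

Lemma gdist_path x y : connect e x y ->
  exists2 p, path e x p & last x p = y /\ size p = gdist x y.
Proof.
case/connectP => p0 /shortenP [p ep up _] ->.
have ltp : size p < #|T| by rewrite -[_.+1]/(size (x :: p)) -(card_uniqP up) max_card.
set P := fun k => [exists q : k.-tuple T, path e x q && (last x q == last x p)].
have hasP' : has P (iota 0 #|T|).
  apply/hasP; exists (size p); first by rewrite mem_iota.
  by apply/existsP; exists (in_tuple p); rewrite /= ep eqxx.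
have := nth_find 0 hasP'; rewrite nth_iota; last by rewrite has_find size_iota in hasP'.
rewrite add0n => /existsP [q /andP [eq /eqP lq]].
by exists q; rewrite // size_tuple.
Qed.

End GraphMetric.

Definition metallic a n (w : n.-tuple 'I_a.+1) : bool :=
  [forall i : 'I_n, (tnth w i == ord_max) ==>
     [exists j : 'I_n, (j.+1 == i :> nat) && (tnth w j == ord0)]].

Record word a n := Word {
  letters :> n.-tuple 'I_a.+1;
  metallic_letters : metallic letters }.

HB.instance Definition _ a n := [isSub for @letters a n].
HB.instance Definition _ a n := [Finite of word a n by <:].

Definition metallic_cube a n : rel (word a n) :=
  fun u v => \sum_(k < n) `|tnth u k - tnth v k|%N == 1.

Lemma metallic_cube_sym a n : symmetric (@metallic_cube a n).
Proof.
by move=> u v; congr (_ == 1); apply: eq_bigr => k _; rewrite distnC.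
Qed.

Lemma metallic_cube_irr a n : irreflexive (@metallic_cube a n).
Proof. by move=> u; rewrite /metallic_cube big1 // => k _; rewrite distnn. Qed.

Lemma metallic_cube_connected a n (u v : word a n) :
  0 < a -> connect (@metallic_cube a n) u v.
Proof.
move=> a0.
have m0 : metallic [tuple (ord0 : 'I_a.+1) | i < n].
  apply/forallP => i; apply/implyP; rewrite tnth_mktuple -val_eqE /= => /eqP E.
  by rewrite -E in a0.
suff H (w : word a n) : connect (@metallic_cube a n) w (Word m0).
  apply: connect_trans (H u) _.
  by rewrite (sym_connect_sym (@metallic_cube_sym a n)).
have [k] := ubnP (\sum_(i < n) tnth w i); elim: k w => // k IHk w lek.
case: (boolP [exists i, tnth w i != ord0]) => [/existsP [i wi]|]; last first.
  rewrite negb_exists => /forallP w0.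
  suff -> : w = Word m0 by apply: connect0.
  apply/val_inj/eq_from_tnth => i; rewrite tnth_mktuple.
  by apply/eqP; have := w0 i; rewrite negbK.
pose f j : 'I_a.+1 := if j == i then inord (tnth w j).-1 else tnth w j.
have wi0 : 0 < tnth w i by rewrite lt0n.
have fi : f i = (tnth w i).-1 :> nat.
  by rewrite /f eqxx inordK // (leq_ltn_trans (leq_pred _)).
have fN j : j != i -> f j = tnth w j by rewrite /f => /negPf ->.
have mf : metallic [tuple f j | j < n].
  apply/forallP => j; rewrite tnth_mktuple; apply/implyP.
  have [->|ji] := eqVneq j i.
    rewrite -val_eqE /= fi => /eqP E; have := ltn_ord (tnth w i).
    by rewrite -(prednK wi0) E ltnn.
  rewrite fN // => wj; have := forallP (metallic_letters w) j.
  rewrite wj => /existsP [l /andP [lj wl]]; apply/existsP; exists l.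
  rewrite lj tnth_mktuple fN //; apply: contraNneq wi => <-; exact: wl.
apply: connect_trans (IHk (Word mf) _).
  apply: connect1; rewrite /metallic_cube (bigD1 i) //= big1 => [|j ji].
    by rewrite tnth_mktuple fi distnEl ?leq_pred // -{1}(prednK wi0) subSnn.
  by rewrite tnth_mktuple fN // distnn.
rewrite -ltnS; apply: leq_trans lek; rewrite ltnS.
rewrite (bigD1 i) //= [X in _ < X](bigD1 i) //= tnth_mktuple fi.
rewrite (eq_bigr (fun j => nat_of_ord (tnth w j))) => [|j ji].
  by rewrite ltn_add2r ltn_predL.
by rewrite tnth_mktuple fN.
Qed.

(* Position k = 1, ..., n is the ordinal i = k - 1, so its parity is that of
   i.+1.  The letter epsilon - 1 is described by (tnth v i).+1 == epsilon, which
   avoids truncated subtraction when epsilon = 0. *)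
Definition Uset a n : {set word a n} :=
  let epsilon := a./2 in
  [set v : word a n |
    [&& #|[set i : 'I_n | tnth v i != epsilon :> nat]| <= 1,
        [forall i : 'I_n, [|| tnth v i == epsilon :> nat,
                              tnth v i == epsilon.+1 :> nat
                            | (tnth v i).+1 == epsilon]],
        [forall i : 'I_n, (tnth v i == epsilon.+1 :> nat) ==> ~~ odd i.+1]
      & [forall i : 'I_n, ((tnth v i).+1 == epsilon) ==> odd i.+1]]].

(* Main.v *)
Require Import Defs.
From mathcomp Require Import all_boot.
From mathcomp Require Import all_algebra zify.

Set Implicit Arguments.
Unset Strict Implicit.
Unset Printing Implicit Defensive.

Import IntDist.

(** Write a = 2e + 1 and n = 2m, and number positions from 0.

    Distance in the cube is the Manhattan distance: lowering a letter
    always leaves a word metallic ([lower_letter]), and two different words can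
    be brought closer by lowering a letter of one of them ([lower_towards],
    [gdist_manhattan]).

    To get far from v, a word w may use at position k an ordinary letter 0 or
    a - 1 = 2e, which achieves e + |v_k - e|, or spend two positions on a block
    0a.  With x_k = v_k - e, such a block on positions k - 1, k achieves
    2e + 1 + x_{k-1} - x_k, which exceeds two ordinary letters (by exactly 1)
    only if x_{k-1} >= 0 >= x_k.  Thus the eccentricity of v is
    2em + sum_k |x_k| + (largest number of disjoint blocks with that sign
    condition); [ecc_blocks] is the lower bound.

    Cut the positions into the pairs (2j, 2j+1).  Each pair either admits a
    block or has a nonzero x_k, so every eccentricity is at least 2em + m.  If
    it equals 2em + m, every pair contributes exactly 1, which forces
    x_{2j} <= 0 <= x_{2j+1} ([balanced_of_ecc]).  But then all m - 1 shifted
    pairs (2j-1, 2j) admit blocks, and this second choice of blocks leaves room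
    for a total deviation sum_k |x_k| of at most 1 ([deviation_of_ecc]).  These
    two conditions describe U ([in_Uset]).

    Conversely, let v be in U.  A word w with at most m - 1 letters a is at
    distance at most 2em + sum_k |x_k| + (m - 1) <= 2em + m.  The only word with
    more letters a is 0a0a...0a ([sparse_count]), and the sign conditions on v
    bound its distance by 2e + 1 on each pair ([ecc_leq_Uset]). *)

(** * Centers of finite graphs *)

Section Center.
Variables (T : finType) (e : rel T).

Lemma ecc_leq_card v : ecc e v <= #|T|.
Proof.
apply/bigmax_leqP => w _; rewrite -[leqRHS](size_iota 0).
exact: find_size.
Qed.

Lemma radius_leq_ecc v : radius e <= ecc e v.
Proof.
rewrite /radius; have := mem_index_enum v.
elim: (index_enum T) => //= x s IHs; rewrite inE big_cons geq_min.
by case/predU1P => [<-|/IHs ->]; rewrite ?leqnn ?orbT.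
Qed.

(** A lower bound of all eccentricities that is attained is the radius, so the
    center can be found without computing any eccentricity exactly. *)
Lemma center_of_bound r v0 :
  (forall v, r <= ecc e v) -> ecc e v0 <= r ->
  center e = [set v | ecc e v <= r].
Proof.
move=> ler lev0.
have -> : r = radius e.
  apply/eqP; rewrite eqn_leq (leq_trans (radius_leq_ecc v0)) // andbT.
  rewrite /radius; elim/big_ind: _ => [|x y rx ry|v _].
  - exact: leq_trans (ler v0) (ecc_leq_card v0).
  - by rewrite leq_min rx.
  - exact: ler.
by apply/setP => v; rewrite !inE eqn_leq radius_leq_ecc andbT.
Qed.

End Center.

(** * Distances in metallic cubes *)

(** Natural-number positions, counted from 0, and values allow sums over
    intervals and linear arithmetic.  Outside the word the value is 0. *)
Definition letter a n (w : word a n) (k : nat) : nat := nth ord0 w k.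

Definition manhattan a n (u v : word a n) :=
  \sum_(0 <= k < n) `|letter u k - letter v k|%N.

Section Distance.
Variables a n : nat.
Implicit Types u v w : word a n.

Lemma tnth_letter w (i : 'I_n) : tnth w i = letter w i :> nat.
Proof. by rewrite (tnth_nth ord0). Qed.

Lemma letter_leq w k : letter w k <= a.
Proof. by rewrite -ltnS; apply: ltn_ord. Qed.

Lemma metallic_cubeE u v : metallic_cube u v = (manhattan u v == 1).
Proof.
rewrite /metallic_cube /manhattan big_mkord; congr (_ == 1).
by apply: eq_bigr => k _; rewrite !tnth_letter.
Qed.

Lemma letter_top w k : k < n -> letter w k = a ->
  0 < k /\ letter w k.-1 = 0.
Proof.
move=> ltkn wk; have /forallP/(_ (Ordinal ltkn)) := metallic_letters w.
rewrite -val_eqE /= tnth_letter /= wk eqxx /= => /existsP[j].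
by rewrite -val_eqE /= tnth_letter => /andP[/eqP <- /eqP].
Qed.

Lemma word_of_letters (f : nat -> nat) :
  (forall k, k < n -> f k <= a) ->
  (forall k, k < n -> f k = a -> 0 < k /\ f k.-1 = 0) ->
  exists w, forall k, k < n -> letter w k = f k.
Proof.
move=> lefa topf; pose t := [tuple (inord (f i) : 'I_a.+1) | i < n].
have tE (i : 'I_n) : tnth t i = f i :> nat.
  by rewrite tnth_mktuple inordK // ltnS lefa.
have mt : metallic t.
  apply/forallP => i; apply/implyP; rewrite -val_eqE /= tE => /eqP fi.
  have [i0 fp] := topf i (ltn_ord i) fi.
  have ltp : i.-1 < n by apply: leq_ltn_trans (leq_pred i) _.
  apply/existsP; exists (Ordinal ltp).
  by rewrite -val_eqE /= tE /= fp prednK // eqxx.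
exists (Word mt) => k ltkn.
by have /= := tnth_letter (Word mt) (Ordinal ltkn); rewrite tE.
Qed.

Lemma letter_inj u v :
  (forall k, k < n -> letter u k = letter v k) -> u = v.
Proof.
move=> uv; apply/val_inj/eq_from_tnth => i; apply/val_inj.
by rewrite /= !tnth_letter uv.
Qed.

(** Lowering a letter never produces an a, and it can only destroy letters other
    than 0, so no letter a loses its predecessor 0. *)
Lemma lower_letter u k : k < n -> 0 < letter u k ->
  exists u', letter u' k = (letter u k).-1 /\
    forall l, l < n -> l != k -> letter u' l = letter u l.
Proof.
move=> ltkn uk.
have [||u' u'E] := @word_of_letters (fun l => letter u l - (l == k)).
- by move=> l ltln; apply: leq_trans (leq_subr _ _) (letter_leq u l).
- move=> l ltln /= fl; have := letter_leq u l.
  case: eqVneq fl => [->|lk] fl leua; first by lia.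
  rewrite subn0 in fl.
  by have [l0 ul] := letter_top ltln fl; rewrite ul.
exists u'; split=> [|l ltln lk]; first by rewrite u'E // eqxx subn1.
by rewrite u'E // (negPf lk) subn0.
Qed.

Lemma sum_change_at (F G : nat -> nat) k :
  k < n -> (forall l, l < n -> l != k -> F l = G l) -> F k = (G k).+1 ->
  \sum_(0 <= l < n) F l = (\sum_(0 <= l < n) G l).+1.
Proof.
move=> ltkn FG Fk; rewrite !big_mkord (bigD1 (Ordinal ltkn)) //= Fk.
rewrite [in RHS](bigD1 (Ordinal ltkn)) //= addSn; congr (_ + _).+1.
by apply: eq_bigr => l; rewrite -val_eqE /= => lk; rewrite FG.
Qed.

Lemma manhattan_refl u : manhattan u u = 0.
Proof. by rewrite /manhattan big1 // => k _; rewrite distnn. Qed.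

Lemma manhattan_sym u v : manhattan u v = manhattan v u.
Proof. by apply: eq_bigr => k _; rewrite distnC. Qed.

Lemma manhattan_triangle u v w :
  manhattan u w <= manhattan u v + manhattan v w.
Proof.
by rewrite /manhattan -big_split; apply: leq_sum => k _; apply: leqD_dist.
Qed.

Lemma lower_towards u v k : k < n -> letter v k < letter u k ->
  exists u', metallic_cube u u' /\ manhattan u v = (manhattan u' v).+1.
Proof.
move=> ltkn ltvu.
have [|u' [u'k u'l]] := @lower_letter u k ltkn; first by apply: leq_trans ltvu.
exists u'; split.
  rewrite metallic_cubeE.
  have -> : manhattan u u' = (manhattan u u).+1; last by rewrite manhattan_refl.
  apply: (sum_change_at ltkn) => [l ltln lk|]; first by rewrite u'l.
  by rewrite u'k; lia.
apply: (sum_change_at ltkn) => [l ltln lk|]; first by rewrite u'l.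
by rewrite u'k; lia.
Qed.

(** Letters of u are lowered towards v at the start of the path; once u lies
    below v, letters of v are lowered instead, at the end of the path.  The path
    thus runs through the meet of u and v, and no letter need ever be raised. *)
Lemma manhattan_path u v : exists2 p,
  path (@metallic_cube a n) u p & last u p = v /\ size p = manhattan u v.
Proof.
have [k] := ubnP (manhattan u v); elim: k u v => // k IHk u v lek.
have [/existsP[i ltvu]|/existsPn levu] :=
    boolP [exists i : 'I_n, letter v i < letter u i].
  have [u' [uu' Du]] := lower_towards (ltn_ord i) ltvu.
  have [|p pp [lp sp]] := IHk u' v; first by lia.
  by exists (u' :: p); rewrite /= ?uu' // sp Du.
have [/existsP[i ltuv]|/existsPn leuv] :=
    boolP [exists i : 'I_n, letter u i < letter v i].
  have [v' [vv' Dv]] := lower_towards (ltn_ord i) ltuv.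
  rewrite manhattan_sym in lek.
  have [|p pp [lp sp]] := IHk u v'; first by rewrite manhattan_sym; lia.
  exists (rcons p v); first by rewrite rcons_path pp lp metallic_cube_sym.
  by rewrite last_rcons size_rcons sp manhattan_sym -Dv manhattan_sym.
have -> : u = v.
  apply: letter_inj => l ltln; apply/eqP; rewrite eqn_leq.
  have := levu (Ordinal ltln); have := leuv (Ordinal ltln).
  by rewrite -!leqNgt => -> ->.
by exists [::]; rewrite ?manhattan_refl.
Qed.

Lemma path_manhattan u p :
  path (@metallic_cube a n) u p -> manhattan u (last u p) <= size p.
Proof.
elim: p u => [|x p IHp] u /=; first by rewrite manhattan_refl.
rewrite metallic_cubeE => /andP[/eqP ux /IHp lep].
by apply: leq_trans (manhattan_triangle _ x _) _; rewrite ux add1n ltnS.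
Qed.

Lemma gdist_manhattan u v : gdist (@metallic_cube a n) u v = manhattan u v.
Proof.
have [p pp [lp sp]] := manhattan_path u v.
apply/eqP; rewrite eqn_leq -{1}sp (gdist_min pp lp) /=.
have [|q qq [<- <-]] := @gdist_path _ (@metallic_cube a n) u v.
  by apply/connectP; exists p.
exact: path_manhattan.
Qed.

Lemma ecc_leqP v r :
  reflect (forall w, manhattan v w <= r) (ecc (@metallic_cube a n) v <= r).
Proof.
apply: (iffP (bigmax_leqP _ _ _)) => H w; last by rewrite gdist_manhattan.
by rewrite -gdist_manhattan H.
Qed.

End Distance.

(** * Sums over consecutive pairs *)

Lemma sum_pairs (F : nat -> nat) m :
  \sum_(0 <= k < m.*2) F k = \sum_(0 <= j < m) (F j.*2 + F j.*2.+1).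
Proof.
elim: m => [|m IHm]; first by rewrite !big_nil.
by rewrite doubleS !big_nat_recr //= IHm addnA.
Qed.

Lemma sum_tight (c : nat -> nat) m :
  (forall j, j < m -> 0 < c j) -> \sum_(0 <= j < m) c j <= m ->
  forall j, j < m -> c j = 1.
Proof.
move=> c0 lec j ltjm; apply/eqP; rewrite eqn_leq c0 // andbT.
have : \sum_(0 <= j < m) (1 + (c j).-1) <= m.
  apply: leq_trans lec; rewrite big_nat [leqRHS]big_nat.
  by apply: leq_sum => i /andP[_ ltim]; rewrite add1n prednK ?c0.
rewrite big_split /= sum_nat_const_nat muln1 subn0 -{3}(addn0 m) leq_add2l.
rewrite leqn0 big_mkord sum_nat_eq0 => /forallP/(_ (Ordinal ltjm)) /=.
by case: (c j) => [|[]].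
Qed.

(** Applied to the positions of the letter a: each pair (2j, 2j+1) contains at
    most one of them.  If every pair contains one, then the first pair has it on
    the right since position 0 is excluded, and this propagates, since an
    element at 2j+1 forbids one at 2j+2. *)
Lemma sparse_count (b : nat -> bool) m :
  b 0 = false -> (forall k, k.+1 < m.*2 -> b k -> ~~ b k.+1) ->
  \sum_(0 <= k < m.*2) b k <= m /\
  (\sum_(0 <= k < m.*2) b k = m -> forall j, j < m -> b j.*2.+1).
Proof.
move=> b0; elim: m => [|m IHm] bS; first by rewrite big_nil.
rewrite doubleS 2?big_nat_recr //=.
have [|lem full] := IHm; first by move=> k ltk; apply: bS; rewrite doubleS; lia.
have b01 : b m.*2 -> ~~ b m.*2.+1 by apply: bS; rewrite doubleS.
split=> [|Em]; first by move: b01; do 2!case: (b _) => //=; lia.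
have Sm : \sum_(0 <= k < m.*2) b k = m.
  by move: b01 Em; do 2!case: (b _) => //=; lia.
have bm : b m.*2.+1.
  suff /negPf b2m : ~~ b m.*2.
    by move: Em; rewrite Sm b2m; case: (b _) => //=; lia.
  case: (m) (full Sm) bS => [|l] fl bS; first by rewrite b0.
  by apply: (bS l.*2.+1); [rewrite !doubleS | apply: fl].
move=> j; rewrite ltnS leq_eqVlt => /predU1P[->|] //; exact: full.
Qed.

(** * Eccentricities *)

Section Eccentricity.
Variables e m : nat.
Local Notation V := (word e.*2.+1 m.*2).
Local Notation ecc v := (ecc (@metallic_cube e.*2.+1 m.*2) v).

Definition deviation (v : V) := \sum_(0 <= k < m.*2) `|letter v k - e|%N.

(** The parities are those of positions counted from 0, hence opposite to the
    parities of positions counted from 1. *)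
Definition balanced (v : V) := forall k, k < m.*2 ->
  if odd k then e <= letter v k else letter v k <= e.

Lemma in_Uset (v : V) :
  v \in Uset e.*2.+1 m.*2 <-> deviation v <= 1 /\ balanced v.
Proof.
have dev1 k : k < m.*2 -> deviation v <= 1 -> `|letter v k - e|%N <= 1.
  move=> ltk; apply: leq_trans; rewrite /deviation big_mkord.
  by rewrite (bigD1 (Ordinal ltk)) //= leq_addr.
have devE : deviation v = \sum_(i < m.*2) `|letter v i - e|%N.
  by rewrite /deviation big_mkord.
have cardE : #|[set i : 'I_m.*2 | tnth v i != e :> nat]|
    = \sum_(i < m.*2) (letter v i != e).
  rewrite cardsE -sum1_card big_mkcond /=; apply: eq_bigr => i _.
  by rewrite unfold_in /= tnth_letter; case: (_ == _).
rewrite inE /= uphalf_double cardE; split.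
  case/and4P => card1 /forallP near /forallP evens /forallP odds.
  have nearP (i : 'I_m.*2) : `|letter v i - e|%N = (letter v i != e).
    by have := near i; rewrite !tnth_letter; lia.
  split; first by rewrite devE (eq_bigr _ (fun i _ => nearP i)).
  move=> k ltk; have := near (Ordinal ltk).
  have := evens (Ordinal ltk); have := odds (Ordinal ltk).
  by rewrite !tnth_letter /=; case: (odd k) => /=; lia.
move=> [dev bal]; apply/and4P; split.
- by apply: leq_trans dev; rewrite devE; apply: leq_sum => i _; lia.
- apply/forallP => i; rewrite tnth_letter.
  by have := dev1 i (ltn_ord i) dev; lia.
- apply/forallP => i; rewrite tnth_letter /=.
  by have := bal i (ltn_ord i); case: (odd i) => /=; lia.
- apply/forallP => i; rewrite tnth_letter /=.
  by have := bal i (ltn_ord i); case: (odd i) => /=; lia.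
Qed.

(** The elements of b are the right ends of the blocks 0a of a word w;
    everywhere else w takes the letter 0 or a - 1 = 2e farther from v.  The sign
    condition makes a block at distance exactly 1 more than 2e plus the
    deviation of its two positions, and this 1 is accounted for at the letter
    a. *)
Lemma ecc_blocks (v : V) (b : nat -> bool) :
  (forall k, k < m.*2 -> b k ->
     [/\ 0 < k, ~~ b k.-1, e <= letter v k.-1 & letter v k <= e]) ->
  e.*2 * m + deviation v + \sum_(0 <= k < m.*2) b k <= ecc v.
Proof.
move=> bP.
pose f k := if b k then e.*2.+1
  else if (k.+1 < m.*2) && b k.+1 then 0
  else if letter v k <= e then e.*2 else 0.
have [k _|k ltk|w wE] := @word_of_letters e.*2.+1 m.*2 f.
- by rewrite /f; do 3!case: ifP => _ //.
- rewrite /f; case: ifP => [bk _|_]; last by do 2!case: ifP => _ //; lia.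
  have [k0 /negPf -> _ _] := bP k ltk bk.
  by rewrite prednK // ltk bk.
have /ecc_leqP/(_ w) := leqnn (ecc v); apply: leq_trans.
have -> : e.*2 * m = \sum_(0 <= k < m.*2) e.
  by rewrite sum_nat_const_nat subn0 -!muln2; lia.
rewrite /deviation -!big_split /= big_nat [leqRHS]big_nat.
apply: leq_sum => k /andP[_ ltk]; rewrite wE // /f.
case: ifP => [bk|nbk].
  by have [_ _ _ le] := bP k ltk bk; lia.
case: ifP => [/andP[ltk1 bk]|_].
  by have [_ _ /= le _] := bP k.+1 ltk1 bk; lia.
by case: ifP => le; lia.
Qed.

(** What the pair (2j, 2j+1) adds to 2e in the distance to the word built from
    the blocks on all such pairs where a block pays off. *)
Definition pair_excess (v : V) j :=
  `|letter v j.*2 - e|%N + `|letter v j.*2.+1 - e|%N +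
  ((e <= letter v j.*2) && (letter v j.*2.+1 <= e)).

(** A pair on which a block does not pay off has a letter different from e. *)
Lemma pair_excess_gt0 v j : 0 < pair_excess v j.
Proof. by rewrite /pair_excess; lia. Qed.

Lemma ecc_pair_excess v :
  e.*2 * m + \sum_(0 <= j < m) pair_excess v j <= ecc v.
Proof.
pose b k := [&& odd k, e <= letter v k.-1 & letter v k <= e].
apply: leq_trans (@ecc_blocks v b _); last first.
  by move=> k _ /and3P[]; case: k => //= k oddk -> ->; rewrite /b (negPf oddk).
rewrite -addnA leq_add2l /deviation -big_split /= sum_pairs.
by apply: leq_sum => j _; rewrite /b /= odd_double /pair_excess /=; lia.
Qed.

Lemma ecc_geq v : e.*2.+1 * m <= ecc v.
Proof.
apply: leq_trans (ecc_pair_excess v); rewrite mulSn addnC leq_add2l.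
rewrite -{1}[m]muln1 -{1}(subn0 m) -sum_nat_const_nat.
by apply: leq_sum => j _; apply: pair_excess_gt0.
Qed.

(** All pair excesses are positive, so they all equal 1: a pair is either
    (e, e), or it admits no block and deviates by 1 in total, which leaves only
    (e-1, e) and (e, e+1). *)
Lemma balanced_of_ecc v : ecc v <= e.*2.+1 * m -> balanced v.
Proof.
move=> /(leq_trans (ecc_pair_excess v)); rewrite mulSn addnC leq_add2r => lem.
have tight := sum_tight (fun j _ => pair_excess_gt0 v j) lem.
move=> k; rewrite -(odd_double_half k); move: (odd k) (k./2) => o j ltj.
have /tight : j < m by lia.
rewrite oddD odd_double oddb /pair_excess.
by case: o {ltj} => /=; rewrite ?add0n ?add1n; lia.
Qed.

(** In a balanced word a block pays off on every shifted pair (2j-1, 2j); these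
    m - 1 blocks alone bring the distance to 2em + deviation + (m - 1). *)
Lemma deviation_of_ecc v :
  0 < m -> balanced v -> ecc v <= e.*2.+1 * m -> deviation v <= 1.
Proof.
move=> m0 bal; pose b k := (0 < k) && ~~ odd k.
have bP k : k < m.*2 -> b k ->
    [/\ 0 < k, ~~ b k.-1, e <= letter v k.-1 & letter v k <= e].
  move=> ltk /andP[k0 evk]; have := bal k ltk; have := bal k.-1.
  have oddp : odd k.-1 by case: k k0 evk {ltk} => //= k _; rewrite negbK.
  rewrite (negPf evk) oddp => lep lek.
  by split; rewrite // ?/b ?oddp ?andbF // lep //; lia.
move=> /(leq_trans (ecc_blocks bP)); rewrite sum_pairs.
have -> : \sum_(0 <= j < m) (b j.*2 + b j.*2.+1) = m.-1.
  rewrite -(prednK m0) big_nat_recl //= /b /=.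
  rewrite (eq_bigr (fun=> 1)) => [|j _]; last by rewrite /= odd_double.
  by rewrite sum_nat_const_nat; lia.
by rewrite mulSn; lia.
Qed.

(** A letter a of w costs at most 1 above e + |v_k - e|, any other letter costs
    at most that.  This settles all words with fewer than m letters a; the word
    0a0a...0a is measured pair by pair, where balance is essential. *)
Lemma ecc_leq_Uset (v : V) :
  deviation v <= 1 -> balanced v -> ecc v <= e.*2.+1 * m.
Proof.
move=> dev bal; apply/ecc_leqP => w.
pose b k := (k < m.*2) && (letter w k == e.*2.+1).
have [||lem full] := @sparse_count b m.
- by apply/negP => /andP[lt0 /eqP/(letter_top lt0)[]].
- move=> k ltk /andP[_ /eqP wk]; rewrite /b ltk; apply/eqP.
  by case/(letter_top ltk) => _ /=; rewrite wk.
have [ltm|] := ltnP (\sum_(0 <= k < m.*2) b k) m.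
  have -> : e.*2.+1 * m = \sum_(0 <= k < m.*2) e + m.
    by rewrite sum_nat_const_nat subn0 -!muln2; lia.
  apply: (@leq_trans (\sum_(0 <= k < m.*2) (e + `|letter v k - e|%N + b k))).
    rewrite /manhattan big_nat [leqRHS]big_nat.
    apply: leq_sum => k /andP[_ ltk].
    rewrite /b ltk; have := letter_leq v k; have := letter_leq w k.
    by case: eqP => //=; lia.
  rewrite !big_split /= -/(deviation v) -addnA leq_add2l.
  exact: leq_trans (leq_add dev (leqnn _)) ltm.
move=> gem; have {}full := full (anti_leq (introT andP (conj lem gem))).
rewrite /manhattan sum_pairs.
have -> : e.*2.+1 * m = \sum_(0 <= j < m) e.*2.+1.
  by rewrite sum_nat_const_nat subn0 mulnC.
rewrite big_nat [leqRHS]big_nat; apply: leq_sum => j /andP[_ ltj].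
have /andP[ltj2 /eqP wj] := full j ltj.
have [_ /= wj0] := letter_top ltj2 wj.
have := bal _ ltj2; have := bal j.*2 (ltnW ltj2); rewrite /= odd_double /=.
by rewrite wj wj0; have := letter_leq v j.*2.+1; lia.
Qed.

Lemma center_metallic_cube : 0 < m ->
  center (@metallic_cube e.*2.+1 m.*2) = Uset e.*2.+1 m.*2.
Proof.
move=> m0; have [k _|k _|v0 v0E] := @word_of_letters e.*2.+1 m.*2 (fun=> e).
- by lia.
- by lia.
rewrite (@center_of_bound _ _ (e.*2.+1 * m) v0); first 1 last.
- exact: ecc_geq.
- apply: ecc_leq_Uset => [|k ltk]; last by rewrite v0E //; case: (odd k).
  rewrite /deviation big_nat big1 // => k /andP[_ ltk].
  by rewrite v0E // distnn.
apply/setP => v; rewrite inE; apply/idP/idP => [lev|/in_Uset[]].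
  have bal := balanced_of_ecc lev.
  by apply/in_Uset; split=> //; apply: deviation_of_ecc lev.
exact: ecc_leq_Uset.
Qed.

End Eccentricity.

Theorem corollary3 (a n : nat) (ha : 1 <= a) (ha_odd : odd a)
    (hn : 2 <= n) (hn_even : ~~ odd n) :
  center (@metallic_cube a n) = Uset a n.
Proof.
have [e Ea] : exists e, a = e.*2.+1 by exists a./2; lia.
have [m En] : exists m, n = m.*2 by exists n./2; lia.
by subst a n; apply: center_metallic_cube; lia.
Qed.
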